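(* Let $p$ be a prime and let $M$ be a $p$-perfect commutative monoid (in spaces). Then: (1) $M$ is a simple space, that is, $\pi_1(M,m)$ is abelian for every $m\in M$, and its action on $\pi_n(M,m)$ is trivial for all $n\geq 1$; (2) $\pi_n(M,m)$ is uniquely $p$-divisible for all $n\geq 1$ (and all $m \in M$).
   Context: ''Commutative monoid'' means a commutative monoid in the $\infty$-category $\mathcal S$ of spaces, i.e. an $\mathbb E_\infty$-monoid (not necessarily grouplike). Every commutative monoid $M$ has a canonical Frobenius map $p\colon M\to M$, $m\mapsto pm=m+\dots+m$, i.e. the composite of the diagonal $M\to M^p$ with the addition $M^p\to M$. $M$ is called $p$-perfect if $p\colon M\to M$ is an equivalence. A group is uniquely $p$-divisible if every element has a unique $p$-th root. *)

(* Defs.v *)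
From HB Require Import structures.
From mathcomp Require Import all_boot all_order all_algebra generic_quotient.
From mathcomp Require Import lra.
From mathcomp Require Import boolp classical_sets reals topology normedtype.

Set Implicit Arguments.
Unset Strict Implicit.
Unset Printing Implicit Defensive.

Import Order.TTheory GRing.Theory Num.Theory.
Import numFieldNormedType.Exports.

Local Open Scope classical_set_scope.
Local Open Scope ring_scope.

Lemma mx_continuous (Z T : topologicalType) m n (f : Z -> 'M[T]_(m, n)) :
  (forall i j, continuous (fun z => f z i j)) -> continuous f.
Proof.
move=> cf z A [P fzP sPA]; apply: (@filterS _ (nbhs z) _
  (fun y => forall i j, P i j (f y i j))); first by move=> y Py; apply: sPA.
by apply: filter_forall => i; apply: filter_forall => j; apply: cf; exact: fzP.
Qed.

Lemma pair_continuous (Z T U : topologicalType) (f : Z -> T) (g : Z -> U) :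
  continuous f -> continuous g -> continuous (fun z => (f z, g z)).
Proof. by move=> cf cg z; apply: cvg_pair; [exact: cf|exact: cg]. Qed.

Lemma comp_continuous (Z T U : topologicalType) (f : Z -> T) (g : T -> U) :
  continuous f -> continuous g -> continuous (fun z => g (f z)).
Proof. by move=> cf cg z; apply: continuous_comp; [exact: cf|exact: cg]. Qed.

Lemma fst_continuous (T U : topologicalType) : continuous (@fst T U).
Proof. by move=> z; exact: cvg_fst. Qed.

Lemma snd_continuous (T U : topologicalType) : continuous (@snd T U).
Proof. by move=> z; exact: cvg_snd. Qed.

Lemma id_continuous (T : topologicalType) : continuous (fun x : T => x).
Proof. by move=> z; exact: cvg_id. Qed.

Lemma const_continuous (T U : topologicalType) (u : U) :
  continuous (fun _ : T => u).
Proof. by move=> z; exact: cvg_cst. Qed.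

Section RealContinuity.
Context (R : realType) (Z : topologicalType).
Implicit Types f g c : Z -> R.

Lemma add_continuous f g :
  continuous f -> continuous g -> continuous (fun z => f z + g z).
Proof. by move=> cf cg z; apply: cvgD; [exact: cf|exact: cg]. Qed.

Lemma opp_continuous f : continuous f -> continuous (fun z => - f z).
Proof. by move=> cf z; apply: cvgN; exact: cf. Qed.

Lemma mul_continuous f g :
  continuous f -> continuous g -> continuous (fun z => f z * g z).
Proof. by move=> cf cg z; apply: cvgM; [exact: cf|exact: cg]. Qed.

Lemma paste_continuous (T : topologicalType) c (f g : Z -> T) :
    continuous c -> continuous f -> continuous g ->
    (forall z, c z = 0 -> f z = g z) ->
  continuous (fun z => if c z <= 0 then f z else g z).
Proof.
move=> cc cf cg fg z A; case: (ltgtP (c z) 0) => [cz|cz|cz] /= fzA.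
- have H : \forall y \near z, c y < 0.
    exact: (cc z _ (open_nbhs_nbhs (conj (@open_lt R 0) cz))).
  apply: (filterS _ (filterI H (cf z A fzA))) => y [cy fyA].
  by rewrite /preimage /= (ltW cy).
- have H : \forall y \near z, 0 < c y.
    exact: (cc z _ (open_nbhs_nbhs (conj (@open_gt R 0) cz))).
  apply: (filterS _ (filterI H (cg z A fzA))) => y [cy gyA].
  by rewrite /preimage /= leNgt cy.
- have gzA : nbhs (g z) A by rewrite -fg.
  have H : nbhs z (f @^-1` A `&` g @^-1` A).
    by apply: filterI; [exact: cf|exact: cg].
  apply: (filterS _ H) => y [fyA gyA].
  by rewrite /preimage /=; case: ifP.
Qed.

Lemma min_continuous f g :
  continuous f -> continuous g -> continuous (fun z => Num.min (f z) (g z)).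
Proof.
move=> cf cg; have -> : (fun z => Num.min (f z) (g z)) =
    (fun z => if f z - g z <= 0 then f z else g z).
  by apply/funext => z; rewrite subr_le0 minEle.
apply: paste_continuous => //; first by apply: add_continuous => //; exact: opp_continuous.
by move=> z /eqP; rewrite subr_eq0 => /eqP.
Qed.

End RealContinuity.

Ltac cont_step := first [assumption | lazymatch goal with |- continuous ?h =>
  lazymatch h with
  | (fun _ => ?c) => exact: const_continuous
  | (fun z => z) => exact: id_continuous
  | (fun _ => fst _) => exact: fst_continuous
  | (fun _ => snd _) => exact: snd_continuous
  | fst => exact: fst_continuous
  | snd => exact: snd_continuous
  | (fun _ => (_, _)) => apply: pair_continuous
  | (fun _ => @Order.min _ _ _ _) => apply: min_continuous
  | (fun _ => @Algebra.add _ _ _) => apply: add_continuous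
  | (fun _ => @Algebra.opp _ _) => apply: opp_continuous
  | (fun _ => fun_of_matrix _ _ _) => exact: coord_continuous
  | @GRing.mul _ _ =>
      exact: (mul_continuous (@const_continuous _ _ _) (@id_continuous _))
  | @Algebra.opp _ => exact: (opp_continuous (@id_continuous _))
  | (fun _ => @GRing.mul _ _ _) => apply: mul_continuous
  end end].
Ltac cont := repeat cont_step.

Section Homotopy.
Context (R : realType) (X Y : topologicalType).

(* Homotopies rel A are parametrised by [0, 1]; taking them defined and
   continuous on all of R is no restriction, since t may be clamped. *)
Definition homotopic (A : set X) (f g : X -> Y) : Prop :=
  exists H : R * X -> Y, [/\ continuous H,
    forall x, H (0, x) = f x, forall x, H (1, x) = g x &
    forall t a, 0 <= t <= 1 -> A a -> H (t, a) = f a].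

Lemma homotopic_refl A f : continuous f -> homotopic A f f.
Proof.
move=> cf; exists (fun z => f z.2); split=> //.
by apply: comp_continuous => //; exact: snd_continuous.
Qed.

Lemma homotopic_sym A f g : homotopic A f g -> homotopic A g f.
Proof.
case=> H [cH H0 H1 HA]; exists (fun z => H (1 - z.1, z.2)); split.
- by apply: (comp_continuous _ cH); cont.
- by move=> x; rewrite /= subr0.
- by move=> x; rewrite /= subrr.
- move=> t a /andP[t0 t1] Aa /=.
  have gf : g a = f a by rewrite -H1 HA ?ler01 ?lexx.
  by rewrite gf HA //; apply/andP; split; lra.
Qed.

Lemma homotopic_trans A f g h :
  homotopic A f g -> homotopic A g h -> homotopic A f h.
Proof.
case=> H [cH H0 H1 HA] [K [cK K0 K1 KA]].
have gf a : A a -> g a = f a by move=> Aa; rewrite -H1 HA ?ler01 ?lexx.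
exists (fun z => if z.1 - 2^-1 <= 0 then H (2 * z.1, z.2)
                 else K (2 * z.1 - 1, z.2)); split.
- apply: paste_continuous; first by cont.
  + by apply: (comp_continuous _ cH); cont.
  + by apply: (comp_continuous _ cK); cont.
  + move=> [t x] /= tE; have -> : 2 * t = 1 by lra.
    by rewrite subrr H1 K0.
- by move=> x /=; rewrite ifT ?mulr0 ?H0//; lra.
- move=> x /=; rewrite ifF; first by rewrite -K1; congr (K (_, _)); lra.
  by apply/negP => ?; lra.
- move=> t a /andP[t0 t1] Aa /=; case: ifP => ht.
    by apply: HA => //; apply/andP; split; lra.
  rewrite -gf//; apply: KA => //; apply/andP; split; move/negP: ht; lra.
Qed.

Lemma homotopic_clamp A f g : homotopic A f g ->
  exists H : R * X -> Y, [/\ continuous H,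
    forall x, H (0, x) = f x, forall x, H (1, x) = g x &
    forall t a, A a -> H (t, a) = f a].
Proof.
case=> H [cH H0 H1 HA]; pose clamp (t : R) := Num.min (- Num.min (- t) 0) 1.
have clamp01 t : 0 <= clamp t <= 1.
  by rewrite /clamp !minEle; case: ifP; case: ifP => *; apply/andP; split; lra.
have clampE t : 0 <= t <= 1 -> clamp t = t.
  by move=> /andP[? ?]; rewrite /clamp !minEle; case: ifP; case: ifP => *; lra.
have cclamp : continuous clamp by rewrite /clamp; cont.
exists (fun z => H (clamp z.1, z.2)); split=> [|x|x|t a Aa] /=.
- apply: (comp_continuous _ cH); apply: pair_continuous; last exact: snd_continuous.
  exact: (comp_continuous (@fst_continuous _ _) cclamp).
- by rewrite clampE ?H0 ?lexx ?ler01.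
- by rewrite clampE ?H1 ?lexx ?ler01.
- exact: HA.
Qed.

End Homotopy.

Definition path_connected (R : realType) (X : topologicalType) (x y : X) : Prop :=
  exists gamma : R -> X, [/\ continuous gamma, gamma 0 = x & gamma 1 = y].

Section Loops.
Context (R : realType) (X : topologicalType).

Definition open_cube n : set 'rV[R]_n := [set s | forall i, 0 < s ord0 i < 1].

(* A map of pairs (I^n, boundary of I^n) -> (X, x), extended to R^n by the
   value x outside of the cube. *)
Record nloop n (x : X) := NLoop {
  nloop_fun :> 'rV[R]_n -> X;
  nloop_continuous : continuous nloop_fun;
  nloop_base : forall s, ~ open_cube s -> nloop_fun s = x }.

HB.instance Definition _ n x := gen_eqMixin (nloop n x).
HB.instance Definition _ n x := gen_choiceMixin (nloop n x).

Definition loop_homotopic n x (f g : nloop n x) : bool :=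
  `[< homotopic R (~` @open_cube n) f g >].

Lemma loop_homotopic_equiv n x : equiv_class_of (@loop_homotopic n x).
Proof.
split=> [f|f g|g f h].
- by apply/asboolP/homotopic_refl/nloop_continuous.
- by apply/asboolP/asboolP => /homotopic_sym.
- by move=> /asboolP fg /asboolP gh; apply/asboolP/(homotopic_trans fg gh).
Qed.

Canonical loop_homotopic_equiv_rel n x := EquivRelPack (loop_homotopic_equiv n x).

Definition homotopy_group n x : Type := {eq_quot @loop_homotopic n x}%qT.

HB.instance Definition _ n x := EqQuotient.on (homotopy_group n x).
HB.instance Definition _ n x := Choice.on (homotopy_group n x).

Definition hclass n x (f : nloop n x) : homotopy_group n x :=
  (\pi_(homotopy_group n x) f)%qT.

Lemma hclassP n x (f g : nloop n x) :
  hclass f = hclass g <-> homotopic R (~` @open_cube n) f g.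
Proof.
by split=> [/eqP|/asboolP H]; [rewrite eqmodE => /asboolP|apply/eqP; rewrite eqmodE].
Qed.

Lemma hclass_repr n x (a : homotopy_group n x) : hclass (repr a) = a.
Proof. exact: reprK. Qed.

Lemma hclassK n x (f : nloop n x) :
  homotopic R (~` @open_cube n) (repr (hclass f)) f.
Proof. by apply/hclassP; rewrite hclass_repr. Qed.

Definition const_nloop n x : nloop n x :=
  NLoop (@const_continuous 'rV[R]_n X x) (fun _ _ => erefl).

End Loops.

Arguments homotopy_group R {X} n x.
Arguments const_nloop {R X} n x.

Section Concatenation.
Context (R : realType) (X : topologicalType) (n : nat).
Implicit Types (s : 'rV[R]_n.+1) (x : X).

Definition set_coord0 (c : R) s : 'rV[R]_n.+1 :=
  \row_j (if j == ord0 then c else s ord0 j).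

Lemma set_coord0_id s : set_coord0 (s ord0 ord0) s = s.
Proof. by apply/rowP => j; rewrite mxE; case: eqP => // ->. Qed.

Lemma set_coord00 c s : set_coord0 c s ord0 ord0 = c.
Proof. by rewrite mxE eqxx. Qed.

Lemma set_coord0K c d s : set_coord0 c (set_coord0 d s) = set_coord0 c s.
Proof. by apply/rowP => j; rewrite !mxE; case: eqP. Qed.

Lemma set_coord0_continuous (Z : topologicalType) (c : Z -> R)
    (s : Z -> 'rV[R]_n.+1) :
  continuous c -> continuous s -> continuous (fun z => set_coord0 (c z) (s z)).
Proof.
move=> cc cs; apply: mx_continuous => i j.
have -> : (fun z => set_coord0 (c z) (s z) i j) =
    (fun z => if j == ord0 then c z else s z ord0 j).
  by apply/funext => z; rewrite mxE.
case: (j == ord0) => //; exact: (comp_continuous cs (@coord_continuous _ _ _ _ _)).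
Qed.

Lemma coord0_continuous : continuous (fun s => s ord0 ord0 : R).
Proof. exact: coord_continuous. Qed.

Lemma set_coord0_out c s :
    (s ord0 ord0 <= 0 -> ~ (0 < c < 1)) -> (1 <= s ord0 ord0 -> ~ (0 < c < 1)) ->
  ~ open_cube s -> ~ open_cube (set_coord0 c s).
Proof.
move=> c0 c1 ns cs; apply: ns => i; have := cs i; rewrite mxE.
case: eqP => [-> c01|//]; apply/andP; split; rewrite ltNge; apply/negP => h.
- exact: (c0 h).
- exact: (c1 h).
Qed.

Ltac contL := cont; try
  (apply: (comp_continuous _ (@nloop_continuous _ _ _ _ _));
   apply: set_coord0_continuous); cont.

Definition concat_fun (f g : 'rV[R]_n.+1 -> X) s : X :=
  if s ord0 ord0 - 2^-1 <= 0 then f (set_coord0 (2 * s ord0 ord0) s)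
  else g (set_coord0 (2 * s ord0 ord0 - 1) s).

Lemma concat_continuous x (f g : nloop R n.+1 x) : continuous (concat_fun f g).
Proof.
apply: paste_continuous; [by contL|by contL|by contL|].
move=> s s0; rewrite !nloop_base// => /(_ ord0); rewrite set_coord00; lra.
Qed.

Lemma concat_base x (f g : nloop R n.+1 x) s :
  ~ open_cube s -> concat_fun f g s = x.
Proof.
rewrite /concat_fun => ns; case: ifP => h; apply: nloop_base;
  apply: set_coord0_out => // hs; move: h; lra.
Qed.

Definition concat x (f g : nloop R n.+1 x) : nloop R n.+1 x :=
  NLoop (@concat_continuous x f g) (@concat_base x f g).

Lemma inverse_continuous x (f : nloop R n.+1 x) :
  continuous (fun s => f (set_coord0 (1 - s ord0 ord0) s)).
Proof. by contL. Qed.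

Lemma inverse_base x (f : nloop R n.+1 x) s :
  ~ open_cube s -> f (set_coord0 (1 - s ord0 ord0) s) = x.
Proof. by move=> ns; apply: nloop_base; apply: set_coord0_out => // hs; lra. Qed.

Definition inverse x (f : nloop R n.+1 x) : nloop R n.+1 x :=
  NLoop (@inverse_continuous x f) (@inverse_base x f).

Let out := ~` @open_cube R n.+1.

Lemma concat_homotopic x (f f' g g' : nloop R n.+1 x) :
    homotopic R out f f' -> homotopic R out g g' ->
  homotopic R out (concat f g) (concat f' g').
Proof.
case/homotopic_clamp=> H [cH H0 H1 HA] /homotopic_clamp[K [cK K0 K1 KA]].
exists (fun z : R * 'rV[R]_n.+1 =>
  concat_fun (fun s => H (z.1, s)) (fun s => K (z.1, s)) z.2).
have c2 : continuous (fun z : R * 'rV[R]_n.+1 => z.2 ord0 ord0 : R).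
  exact: (comp_continuous (@snd_continuous _ _) coord0_continuous).
split.
- apply: paste_continuous.
  + by apply: add_continuous => //; exact: const_continuous.
  + apply: (comp_continuous _ cH); apply: pair_continuous; first exact: fst_continuous.
    apply: set_coord0_continuous; last exact: snd_continuous.
    by apply: mul_continuous => //; exact: const_continuous.
  + apply: (comp_continuous _ cK); apply: pair_continuous; first exact: fst_continuous.
    apply: set_coord0_continuous; last exact: snd_continuous.
    apply: add_continuous; last exact: const_continuous.
    by apply: mul_continuous => //; exact: const_continuous.
  + move=> [t s] /= s0; rewrite HA ?KA;
      try (by move=> /(_ ord0); rewrite set_coord00; lra).
    by rewrite !nloop_base// => /(_ ord0); rewrite set_coord00; lra.
- by move=> s; rewrite /= /concat_fun; case: ifP => _; rewrite ?H0 ?K0.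
- by move=> s; rewrite /= /concat_fun; case: ifP => _; rewrite ?H1 ?K1.
- move=> t s t01 ns /=; rewrite /concat_fun; case: ifP => h; [apply: HA|apply: KA];
    by apply: set_coord0_out => // hs; move: h; lra.
Qed.

Lemma inverse_homotopic x (f f' : nloop R n.+1 x) :
  homotopic R out f f' -> homotopic R out (inverse f) (inverse f').
Proof.
case=> H [cH H0 H1 HA].
exists (fun z : R * 'rV[R]_n.+1 => H (z.1, set_coord0 (1 - z.2 ord0 ord0) z.2)); split => //=.
- apply: (comp_continuous _ cH); apply: pair_continuous; first exact: fst_continuous.
  apply: set_coord0_continuous; last exact: snd_continuous.
  apply: add_continuous; first exact: const_continuous.
  apply: opp_continuous.
  exact: (comp_continuous (@snd_continuous _ _) coord0_continuous).
- by move=> t s t01 ns; apply: HA => //; apply: set_coord0_out => // hs; lra.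
Qed.

Lemma reparam_homotopic x (f g : nloop R n.+1 x) (phi : R -> R) :
    continuous phi -> (forall t, t <= 0 -> phi t <= 0) ->
    (forall t, 1 <= t -> 1 <= phi t) ->
    (forall s, g s = f (set_coord0 (phi (s ord0 ord0)) s)) ->
  homotopic R out g f.
Proof.
move=> cphi phi0 phi1 gE.
exists (fun z : R * 'rV[R]_n.+1 => f (set_coord0 ((1 - z.1) * phi (z.2 ord0 ord0)
                                + z.1 * z.2 ord0 ord0) z.2)).
have c2 : continuous (fun z : R * 'rV[R]_n.+1 => z.2 ord0 ord0 : R).
  exact: (comp_continuous (@snd_continuous _ _) coord0_continuous).
split=> /=.
- apply: (comp_continuous _ (@nloop_continuous _ _ _ _ _)).
  apply: set_coord0_continuous; last exact: snd_continuous.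
  apply: add_continuous; apply: mul_continuous => //; [|exact: comp_continuous|];
    by cont.
- by move=> s; rewrite gE subr0 mul1r mul0r addr0.
- by move=> s; rewrite subrr mul0r add0r mul1r set_coord0_id.
- move=> t s /andP[t0 t1] ns; rewrite [RHS]nloop_base// nloop_base//.
  apply: set_coord0_out => // hs.
  + by have := phi0 _ hs; nra.
  + by have := phi1 _ hs; nra.
Qed.

Lemma null_homotopic x (f g : nloop R n.+1 x) (phi : R -> R) :
    continuous phi -> (forall t, t <= 0 -> phi t <= 0) ->
    (forall t, 1 <= t -> phi t <= 0) -> (forall t, phi t <= 1) ->
    (forall s, g s = f (set_coord0 (phi (s ord0 ord0)) s)) ->
  homotopic R out g (const_nloop n.+1 x).
Proof.
move=> cphi phi0 phi1 phiM gE.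
exists (fun z : R * 'rV[R]_n.+1 => f (set_coord0 (phi (z.2 ord0 ord0) - z.1) z.2)).
have c2 : continuous (fun z : R * 'rV[R]_n.+1 => z.2 ord0 ord0 : R).
  exact: (comp_continuous (@snd_continuous _ _) coord0_continuous).
split=> /=.
- apply: (comp_continuous _ (@nloop_continuous _ _ _ _ _)).
  apply: set_coord0_continuous; last exact: snd_continuous.
  apply: add_continuous; first exact: (comp_continuous c2 cphi).
  by apply: opp_continuous; exact: fst_continuous.
- by move=> s; rewrite gE subr0.
- move=> s; rewrite nloop_base// => /(_ ord0); rewrite set_coord00.
  by have := phiM (s ord0 ord0); lra.
- move=> t s /andP[t0 t1] ns; rewrite [RHS]nloop_base// nloop_base//.
  apply: set_coord0_out => // hs.
  + by have := phi0 _ hs; lra.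
  + by have := phi1 _ hs; lra.
Qed.

Lemma concatA x (f g h : nloop R n.+1 x) :
  homotopic R out (concat (concat f g) h) (concat f (concat g h)).
Proof.
apply: (@reparam_homotopic _ _ _
  (fun t => Num.min (2 * t) (Num.min (t + 4^-1) (2^-1 * (t + 1))))).
- by cont.
- by move=> t t0; rewrite !minEle; repeat case: ifP => //; lra.
- by move=> t t0; rewrite !minEle; repeat case: ifP => //; lra.
- move=> s /=; rewrite /concat_fun /= /concat_fun !set_coord00 !set_coord0K.
  set t : R := s ord0 ord0; rewrite !minEle.
  repeat case: ifP => //; move=> *;
    solve [exfalso; lra | congr (_ (set_coord0 _ _)); lra].
Qed.

Lemma concat1l x (f : nloop R n.+1 x) :
  homotopic R out (concat (const_nloop n.+1 x) f) f.
Proof.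
apply: (@reparam_homotopic _ _ _ (fun t => 2 * t - 1)).
- by cont.
- by move=> t; lra.
- by move=> t; lra.
- move=> s /=; rewrite /concat_fun; case: ifP => // h.
  by rewrite [RHS]nloop_base// => /(_ ord0); rewrite set_coord00; lra.
Qed.

Lemma concat1r x (f : nloop R n.+1 x) :
  homotopic R out (concat f (const_nloop n.+1 x)) f.
Proof.
apply: (@reparam_homotopic _ _ _ (fun t => 2 * t)).
- by cont.
- by move=> t; lra.
- by move=> t; lra.
- move=> s /=; rewrite /concat_fun; case: ifP => // h.
  by rewrite [RHS]nloop_base// => /(_ ord0); rewrite set_coord00; lra.
Qed.

Lemma concatVr x (f : nloop R n.+1 x) :
  homotopic R out (concat f (inverse f)) (const_nloop n.+1 x).
Proof.
apply: (@null_homotopic _ f _ (fun t => Num.min (2 * t) (2 - 2 * t))).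
- by cont.
- by move=> t t0; rewrite !minEle; repeat case: ifP => //; lra.
- by move=> t t0; rewrite !minEle; repeat case: ifP => //; lra.
- by move=> t; rewrite !minEle; repeat case: ifP => //; lra.
- move=> s /=; rewrite /concat_fun /= !set_coord00 !set_coord0K minEle.
  repeat case: ifP => //; move=> *;
    solve [exfalso; lra | congr (_ (set_coord0 _ _)); lra].
Qed.

Lemma inverseK x (f : nloop R n.+1 x) : inverse (inverse f) = f :> (_ -> _).
Proof.
by apply/funext => s /=; rewrite set_coord00 set_coord0K subKr set_coord0_id.
Qed.

Lemma concatVl x (f : nloop R n.+1 x) :
  homotopic R out (concat (inverse f) f) (const_nloop n.+1 x).
Proof.
have -> : concat (inverse f) f = concat (inverse f) (inverse (inverse f)) :> (_ -> _).
  by rewrite /= -{2}(inverseK f).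
exact: concatVr.
Qed.

Let G x := homotopy_group R n.+1 x.

Definition pi_mul x (a b : G x) : G x := hclass (concat (repr a) (repr b)).
Definition pi_one x : G x := hclass (const_nloop n.+1 x).
Definition pi_inv x (a : G x) : G x := hclass (inverse (repr a)).

Lemma pi_mulE x (f g : nloop R n.+1 x) :
  pi_mul (hclass f) (hclass g) = hclass (concat f g).
Proof. by apply/hclassP/concat_homotopic; exact: hclassK. Qed.

Lemma pi_invE x (f : nloop R n.+1 x) : pi_inv (hclass f) = hclass (inverse f).
Proof. by apply/hclassP/inverse_homotopic; exact: hclassK. Qed.

Lemma pi_mulA x : associative (@pi_mul x).
Proof.
move=> a b c; rewrite -[a]hclass_repr -[b]hclass_repr -[c]hclass_repr !pi_mulE.
by symmetry; apply/hclassP/concatA.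
Qed.

Lemma pi_mul1g x : left_id (@pi_one x) (@pi_mul x).
Proof. by move=> a; rewrite -[a]hclass_repr pi_mulE; apply/hclassP/concat1l. Qed.

Lemma pi_mulg1 x : right_id (@pi_one x) (@pi_mul x).
Proof. by move=> a; rewrite -[a]hclass_repr pi_mulE; apply/hclassP/concat1r. Qed.

Lemma pi_mulVg x : left_inverse (@pi_one x) (@pi_inv x) (@pi_mul x).
Proof.
by move=> a; rewrite -[a]hclass_repr pi_invE pi_mulE; apply/hclassP/concatVl.
Qed.

Lemma pi_mulgV x : right_inverse (@pi_one x) (@pi_inv x) (@pi_mul x).
Proof.
by move=> a; rewrite -[a]hclass_repr pi_invE pi_mulE; apply/hclassP/concatVr.
Qed.

HB.instance Definition _ x := isGroup.Build (homotopy_group R n.+1 x)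
  (@pi_mulA x) (@pi_mul1g x) (@pi_mulg1 x) (@pi_mulVg x) (@pi_mulgV x).

End Concatenation.

Section Action.
Context (R : realType) (X : topologicalType) (n : nat).
Implicit Types (s : 'rV[R]_n) (x : X).

Definition center_dist s : R := `|s - const_mx 2^-1|.

Lemma center_distP s i : `|s ord0 i - 2^-1| <= center_dist s.
Proof.
have -> : center_dist s = mx_norm (s - const_mx 2^-1) by [].
rewrite mx_normrE; apply: le_trans (le_bigmax _ _ (ord0, i)).
by rewrite !mxE.
Qed.

Lemma center_dist_max s : 0 < center_dist s ->
  exists i, `|s ord0 i - 2^-1| = center_dist s.
Proof.
move=> s0; have [|[i j] sE] := @mx_norm_neq0 _ _ _ (s - const_mx 2^-1).
  by rewrite gt_eqF.
by exists j; rewrite /center_dist [RHS]sE /= (ord1 i) !mxE.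
Qed.

Lemma center_dist_continuous : continuous center_dist.
Proof.
apply: (comp_continuous _ (@norm_continuous _ _)).
apply: mx_continuous => i j.
have -> : (fun s => (s - const_mx 2^-1) i j) = (fun s => s i j - 2^-1).
  by apply/funext => s; rewrite !mxE.
apply: add_continuous; [exact: coord_continuous|exact: const_continuous].
Qed.

Lemma center_dist_out s : ~ open_cube s -> 2^-1 <= center_dist s.
Proof.
move=> /existsNP[i /negP]; rewrite negb_and -!leNgt => si.
apply: le_trans (center_distP s i); rewrite ler_normr.
by case/orP: si => si; apply/orP; [right|left]; lra.
Qed.

Definition inner_cube s : 'rV[R]_n := 2 *: s - const_mx 2^-1.

Lemma inner_cube_continuous : continuous inner_cube.
Proof.
apply: mx_continuous => i j.
have -> : (fun s => inner_cube s i j) = (fun s => 2 * s i j - 2^-1).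
  by apply/funext => s; rewrite !mxE.
apply: add_continuous; last exact: const_continuous.
apply: mul_continuous; [exact: const_continuous|exact: coord_continuous].
Qed.

Lemma inner_cube_out s : center_dist s = 4^-1 -> ~ open_cube (inner_cube s).
Proof.
move=> sE; have [|i si] := @center_dist_max s; first by rewrite sE; lra.
move=> /(_ i); rewrite !mxE => /andP[s0 s1]; move: si; rewrite sE.
by case: (ler0P (s ord0 i - 2^-1)) => _ h; lra.
Qed.

Definition radial s : 'rV[R]_1 := const_mx (2 - 4 * center_dist s).

Lemma radial_continuous : continuous radial.
Proof.
apply: mx_continuous => i j.
have -> : (fun s => radial s i j) = (fun s => 2 - 4 * center_dist s).
  by apply/funext => s; rewrite !mxE.
have cd := center_dist_continuous; cont.
Qed.

Lemma radial_out s : (center_dist s <= 4^-1) || (2^-1 <= center_dist s) ->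
  ~ open_cube (radial s).
Proof. by move=> h /(_ ord0); rewrite mxE; case/orP: h; lra. Qed.

(* The loop gamma is run along the radial segments of the shell between the
   boundary of the cube and the cube of half its size with the same centre; f is
   put on the latter. *)
Definition act_fun (gamma : 'rV[R]_1 -> X) (f : 'rV[R]_n -> X) s : X :=
  if center_dist s - 4^-1 <= 0 then f (inner_cube s) else gamma (radial s).

Lemma act_continuous x (gamma : nloop R 1 x) (f : nloop R n x) :
  continuous (act_fun gamma f).
Proof.
apply: paste_continuous.
- by have cd := center_dist_continuous; cont.
- exact: (comp_continuous inner_cube_continuous (@nloop_continuous _ _ _ _ _)).
- exact: (comp_continuous radial_continuous (@nloop_continuous _ _ _ _ _)).
- move=> s sE; rewrite !nloop_base//; first by apply: radial_out; lra.
  by apply: inner_cube_out; lra.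
Qed.

Lemma act_base x (gamma : nloop R 1 x) (f : nloop R n x) s :
  ~ open_cube s -> act_fun gamma f s = x.
Proof.
move=> /center_dist_out h; rewrite /act_fun ifF; last by apply/negP; lra.
by apply: nloop_base; apply: radial_out; rewrite h orbT.
Qed.

Definition act_nloop x (gamma : nloop R 1 x) (f : nloop R n x) : nloop R n x :=
  NLoop (@act_continuous x gamma f) (@act_base x gamma f).

Definition pi1_act x (c : homotopy_group R 1 x) (a : homotopy_group R n x) :
  homotopy_group R n x := hclass (act_nloop (repr c) (repr a)).

Lemma pi1_actE x (gamma : nloop R 1 x) (f : nloop R n x) :
  pi1_act (hclass gamma) (hclass f) = hclass (act_nloop gamma f).
Proof.
apply/hclassP; have /homotopic_clamp[H [cH H0 H1 HA]] := hclassK gamma.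
have /homotopic_clamp[K [cK K0 K1 KA]] := hclassK f.
exists (fun z : R * 'rV[R]_n =>
  act_fun (fun u => H (z.1, u)) (fun s => K (z.1, s)) z.2).
split=> [|s|s|t s t01 ns] /=.
- apply: paste_continuous.
  + have cd := comp_continuous (@snd_continuous R 'rV[R]_n) center_dist_continuous.
    by apply: add_continuous => //; exact: const_continuous.
  + apply: (comp_continuous _ cK); apply: pair_continuous; first exact: fst_continuous.
    exact: (comp_continuous (@snd_continuous _ _) inner_cube_continuous).
  + apply: (comp_continuous _ cH); apply: pair_continuous; first exact: fst_continuous.
    exact: (comp_continuous (@snd_continuous _ _) radial_continuous).
  + move=> [t s] /= sE.
    have iout : ~ open_cube (inner_cube s) by apply: inner_cube_out; lra.
    have rout : ~ open_cube (radial s) by apply: radial_out; lra.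
    by rewrite HA// KA// !nloop_base.
- by rewrite /act_fun; case: ifP => _; rewrite ?H0 ?K0.
- by rewrite /act_fun; case: ifP => _; rewrite ?H1 ?K1.
- have h := center_dist_out ns.
  have rout : ~ open_cube (radial s) by apply: radial_out; rewrite h orbT.
  rewrite [RHS]act_base// /act_fun ifF; last by apply/negP; lra.
  by rewrite HA// nloop_base.
Qed.

End Action.

Section InducedMap.
Context (R : realType) (X Y : topologicalType) (f : X -> Y) (cf : continuous f).
Context (n : nat) (x : X).

Lemma map_nloop_base (g : nloop R n x) s : ~ open_cube s -> f (g s) = f x.
Proof. by move=> ns; rewrite nloop_base. Qed.

Definition map_nloop (g : nloop R n x) : nloop R n (f x) :=
  NLoop (comp_continuous (@nloop_continuous _ _ _ _ g) cf) (@map_nloop_base g).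

Definition pi_map (a : homotopy_group R n x) : homotopy_group R n (f x) :=
  hclass (map_nloop (repr a)).

Lemma pi_mapE (g : nloop R n x) : pi_map (hclass g) = hclass (map_nloop g).
Proof.
apply/hclassP; have [H [cH H0 H1 HA]] := hclassK g.
exists (fun z => f (H z)); split => [|s|s|t s t01 ns] /=.
- exact: comp_continuous.
- by rewrite H0.
- by rewrite H1.
- by rewrite HA.
Qed.

End InducedMap.

(* The middle two items say that f is bijective on path components. *)
Record weak_equivalence (R : realType) (X Y : topologicalType) (f : X -> Y) :
    Prop := WeakEquivalence {
  weq_continuous : continuous f;
  weq_pi0_inj : forall x y,
    path_connected R (f x) (f y) -> path_connected R x y;
  weq_pi0_surj : forall y, exists x, path_connected R (f x) y;
  weq_pi_bij : forall n x,
    bijective (@pi_map R X Y f weq_continuous n.+1 x) }.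

(* Pointed maps <m> -> <n>, where <n> is 'I_n with a base point added; None
   stands for the base point of the target. *)
Definition pmap_fin m n := {ffun 'I_m -> option 'I_n}.

Definition pmap_id n : pmap_fin n n := [ffun i => Some i].

Definition pmap_comp l m n (g : pmap_fin m n) (f : pmap_fin l m) : pmap_fin l n :=
  [ffun i => obind g (f i)].

Definition pmap_rho n (i : 'I_n) : pmap_fin n 1 :=
  [ffun j => if j == i then Some ord0 else None].

Definition pmap_fold n : pmap_fin n 1 := [ffun => Some ord0].

Record gamma_space := GammaSpace {
  gamma_obj :> nat -> topologicalType;
  gamma_map : forall m n, pmap_fin m n -> gamma_obj m -> gamma_obj n;
  gamma_continuous : forall m n (f : pmap_fin m n), continuous (gamma_map f);
  gamma_id : forall n x, gamma_map (pmap_id n) x = x;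
  gamma_comp : forall l m n (g : pmap_fin m n) (f : pmap_fin l m) x,
    gamma_map (pmap_comp g f) x = gamma_map g (gamma_map f x) }.

Definition segal_map (M : gamma_space) n (x : M n) : {ptws 'I_n -> M 1} :=
  fun i => gamma_map (pmap_rho i) x.

(* A commutative monoid in the oo-category of spaces is a functor from finite
   pointed sets to spaces whose Segal maps are equivalences. Such a functor can
   always be strictified to a functor to topological spaces. *)
Record comm_monoid (R : realType) := CommMonoid {
  comm_monoid_gamma :> gamma_space;
  comm_monoid_segal : forall n,
    weak_equivalence R (@segal_map comm_monoid_gamma n) }.

Definition underlying (R : realType) (M : comm_monoid R) : topologicalType := M 1.

Definition diagonal (X : topologicalType) n (x : X) : {ptws 'I_n -> X} :=
  fun=> x.
Arguments diagonal {X} n x.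

Definition addition (R : realType) (M : comm_monoid R) n : M n -> underlying M :=
  gamma_map (pmap_fold n).

(* The Frobenius is the composite
     M --diagonal--> M^p <--segal_map-- M<p> --addition--> M
   in the homotopy category, in which weak equivalences are inverted.  A span
   M <--q-- W --phi--> M with q a weak equivalence represents it if phi is
   addition \o h, where h lifts diagonal \o q along the Segal map up to
   homotopy; the homotopy class of phi \o q^-1 is then determined. *)
Definition represents_frobenius (R : realType) (p : nat) (M : comm_monoid R)
    (W : topologicalType) (q phi : W -> underlying M) : Prop :=
  weak_equivalence R q /\
  exists h : W -> M p, [/\ continuous h,
    homotopic R set0 (fun w => segal_map (h w)) (fun w => diagonal p (q w)) &
    phi = (fun w => addition (h w))].

Definition p_perfect (R : realType) (p : nat) (M : comm_monoid R) : Prop :=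
  exists (W : topologicalType) (q phi : W -> underlying M),
    represents_frobenius p q phi /\ weak_equivalence R phi.

Definition simple_space (R : realType) (X : topologicalType) : Prop :=
  forall x : X,
    (forall a b : homotopy_group R 1 x, (a * b)%g = (b * a)%g) /\
    (forall n (c : homotopy_group R 1 x) (a : homotopy_group R n.+1 x),
       pi1_act c a = a).

Definition uniquely_divisible (p : nat) (G : groupType) : Prop :=
  forall a : G, exists! b : G, (b ^+ p)%g = a.

(* Main.v *)
Require Import Defs.
From mathcomp Require Import all_boot all_order all_algebra reals topology.
From mathcomp Require Import boolp classical_sets normedtype perm lra.

(** Let q : W -> M be the equivalence through which the Frobenius is represented
    and h : W -> M<p> the lift of the diagonal of q.  Fix a point w of W, put
    y = h(w), and write phi = fold o h for the Frobenius, so that phi induces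
    bijections on all homotopy groups.  By the Segal condition an element of pi_n(M<p>, y) is the
    same as a family of p elements of the groups pi_n(M, y_i), where y_i is the
    i-th component of y.  For a in pi_n(W, w) let tau_i(a) in pi_n(M, phi(w))
    be the image under the addition of the element with i-th component that of
    h_*(a) and all the others trivial (summand).  Distinct components
    do not interact, so tau_i(a) and tau_j(b) commute for i <> j, the class
    tau_i(c) acts trivially on tau_j(a), and phi_*(a) is the product of all the
    tau_i(a).

    The heart of the matter is that tau_i = tau_j (summand_eq).  A permutation t
    of the p coordinates does not change the sum, but it moves y to another
    point t(y).  Since all the components y_i are joined to the one point q(w),
    there is a distinguished path from y to t(y), and its image under the
    addition is a loop gamma_t at phi(w) (permutation_loop).  Transport along
    that path compares a family with the permuted one.  Applied to a family all
    of whose components come from the same a in pi_n(W, w), it shows that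
    gamma_t acts trivially on phi_*(a); as phi_* is onto, gamma_t acts trivially
    on everything (permutation_loop_central).  Applied to a family concentrated
    in one coordinate, it shows that gamma_t carries tau_i(a) to tau_j(a) when t
    exchanges i and j.  Hence tau_i(a) = tau_j(a).

    Writing tau for the common value, phi_*(a) = tau(a)^p (phi_summand), and
    tau(a), tau(b) commute because two different indices are available.  So the
    image of phi_*, which is everything, is commutative and acted on trivially.
    A p-th root of phi_*(a) is tau(a), and tau, being a homomorphism with
    tau(a)^p = phi_*(a), makes p-th roots unique.  This settles the base points
    phi(w); every other point is joined to one of them by a path, along which
    everything is transported.

    The tool for all this is the transport of homotopy groups along a path,
    which for a loop is the action of the fundamental group.  It is handled
    through free homotopies, maps of the cylinder R x R^n that are equal
    to the path outside of the open cube: any free homotopy computes the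
    transport (transportP), so that the naturality, additivity and composition
    laws reduce to writing down free homotopies. *)

Set Implicit Arguments.
Unset Strict Implicit.
Unset Printing Implicit Defensive.

Import Order.TTheory GRing.Theory Num.Theory.
Import numFieldNormedType.Exports.

Local Open Scope classical_set_scope.
Local Open Scope ring_scope.

(** * Paths and loops *)

Section RouteFunctions.
Context (R : realType) (X : topologicalType).
Implicit Types g : R -> X.

Definition route_cat g g' (t : R) : X :=
  if t - 2^-1 <= 0 then g (2 * t) else g' (2 * t - 1).

Definition route_rev g (t : R) : X := g (1 - t).

End RouteFunctions.

(** Paths are defined on all of R, as the homotopies are; only the values
    on [0, 1] are constrained by the end points. *)
Record route (R : realType) (X : topologicalType) (x y : X) := Route {
  route_fun :> R -> X;
  route_continuous : continuous route_fun;
  route0 : route_fun 0 = x;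
  route1 : route_fun 1 = y }.

Section Route.
Context (R : realType) (X : topologicalType).
Implicit Types x y z : X.

Lemma route_cat_continuous x y z (g : route R x y) (g' : route R y z) :
  continuous (route_cat g g').
Proof.
apply: paste_continuous; first by cont.
- by apply: (comp_continuous _ (@route_continuous _ _ _ _ g)); cont.
- by apply: (comp_continuous _ (@route_continuous _ _ _ _ g')); cont.
- move=> t tE; have -> : 2 * t = 1 by lra.
  by rewrite subrr route0 route1.
Qed.

Lemma route_cat0 x y z (g : route R x y) (g' : route R y z) :
  route_cat g g' 0 = x.
Proof. by rewrite /route_cat ifT ?mulr0 ?route0//; lra. Qed.

Lemma route_cat1 x y z (g : route R x y) (g' : route R y z) :
  route_cat g g' 1 = z.
Proof.
rewrite /route_cat ifF; last by apply/negP; lra.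
by rewrite (_ : 2 * 1 - 1 = 1) ?route1//; lra.
Qed.

Definition cat_route x y z (g : route R x y) (g' : route R y z) : route R x z :=
  Route (@route_cat_continuous _ _ _ g g') (route_cat0 g g') (route_cat1 g g').

Lemma route_rev_continuous x y (g : route R x y) : continuous (route_rev g).
Proof. by apply: (comp_continuous _ (@route_continuous _ _ _ _ g)); cont. Qed.

Lemma route_rev0 x y (g : route R x y) : route_rev g 0 = y.
Proof. by rewrite /route_rev subr0 route1. Qed.

Lemma route_rev1 x y (g : route R x y) : route_rev g 1 = x.
Proof. by rewrite /route_rev subrr route0. Qed.

Definition rev_route x y (g : route R x y) : route R y x :=
  Route (@route_rev_continuous _ _ g) (route_rev0 g) (route_rev1 g).

(** Changes the end points along propositional equalities; the underlying
    function stays the same, so that no dependent cast enters the terms. *)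
Definition cast_route x y x' y' (xx' : x = x') (yy' : y = y') (g : route R x y) :
    route R x' y' :=
  Route (@route_continuous _ _ _ _ g) (etrans (route0 g) xx')
    (etrans (route1 g) yy').

Lemma map_route0 (Y : topologicalType) (k : X -> Y) x y (g : route R x y) :
  k (g 0) = k x.
Proof. by rewrite route0. Qed.

Lemma map_route1 (Y : topologicalType) (k : X -> Y) x y (g : route R x y) :
  k (g 1) = k y.
Proof. by rewrite route1. Qed.

Definition map_route (Y : topologicalType) (k : X -> Y) (ck : continuous k) x y
    (g : route R x y) : route R (k x) (k y) :=
  Route (comp_continuous (@route_continuous _ _ _ _ g) ck)
    (map_route0 k g) (map_route1 k g).

Lemma loop_route_continuous x (c : nloop R 1 x) :
  continuous (fun t : R => c (const_mx t)).
Proof.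
apply: (comp_continuous _ (@nloop_continuous _ _ _ _ c)).
apply: mx_continuous => i j.
have -> : (fun t : R => (const_mx t : 'rV[R]_1) i j) = id.
  by apply/funext => t; rewrite mxE.
exact: id_continuous.
Qed.

Lemma loop_route_base x (c : nloop R 1 x) (t : R) :
  ~ (0 < t < 1) -> c (const_mx t) = x.
Proof. by move=> t01; apply: nloop_base => /(_ ord0); rewrite mxE. Qed.

Lemma loop_route0 x (c : nloop R 1 x) : c (const_mx 0) = x.
Proof. by apply: loop_route_base; rewrite ltxx. Qed.

Lemma loop_route1 x (c : nloop R 1 x) : c (const_mx 1) = x.
Proof. by apply: loop_route_base; rewrite ltxx andbF. Qed.

Definition loop_route x (c : nloop R 1 x) : route R x x :=
  Route (@loop_route_continuous x c) (loop_route0 c) (loop_route1 c).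

(** The retraction of R onto [0, 1]: it makes a path with equal end points
    constant outside of the cube, as loops have to be. *)
Definition clamp (t : R) : R := - Num.min 0 (- Num.min t 1).

Lemma route_loop_continuous x (g : route R x x) :
  continuous (fun s : 'rV[R]_1 => g (clamp (s ord0 ord0))).
Proof.
apply: (comp_continuous _ (@route_continuous _ _ _ _ g)); rewrite /clamp.
have cs := @coord_continuous R 1 1 ord0 ord0.
by cont.
Qed.

Lemma route_loop_base x (g : route R x x) (s : 'rV[R]_1) :
  ~ open_cube s -> g (clamp (s ord0 ord0)) = x.
Proof.
move=> ns; have : clamp (s ord0 ord0) = 0 \/ clamp (s ord0 ord0) = 1.
  have {ns} : ~ 0 < s ord0 ord0 < 1 by move=> h; apply: ns => i; rewrite (ord1 i).
  move=> /negP; rewrite negb_and -!leNgt /clamp !minEle.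
  by case/orP => h; [left|right]; do 2 case: ifP; lra.
by case=> ->; rewrite ?route0 ?route1.
Qed.

Definition route_loop x (g : route R x x) : nloop R 1 x :=
  NLoop (@route_loop_continuous x g) (@route_loop_base x g).

Lemma loop_routeK x (c : nloop R 1 x) : route_loop (loop_route c) = c :> (_ -> _).
Proof.
apply/funext => s /=.
have sE : s = const_mx (s ord0 ord0) by apply/rowP => i; rewrite mxE ord1.
have [s01|s01] := pselect (0 < s ord0 ord0 < 1).
  rewrite [in RHS]sE; congr (c (const_mx _)).
  by move: s01; rewrite /clamp !minEle; do 2 case: ifP; lra.
rewrite [RHS]nloop_base; last by move=> /(_ ord0).
apply: loop_route_base; apply: contra_not s01.
by rewrite /clamp !minEle; do 2 case: ifP; lra.
Qed.

End Route.

(** * Free homotopies and transport along a path *)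

Section Zoom.
Context (R : realType) (n : nat).
Implicit Types (s : 'rV[R]_n) (l : R).

(** The homothety with ratio l about the centre of the cube; the inner cube
    of half the size is what zoom 2 blows up to the whole cube. *)
Definition zoom l s : 'rV[R]_n := l *: (s - const_mx 2^-1) + const_mx 2^-1.

Lemma zoom1 s : zoom 1 s = s.
Proof. by rewrite /zoom scale1r subrK. Qed.

Lemma zoom2 s : zoom 2 s = inner_cube s.
Proof. by apply/rowP => i; rewrite !mxE; lra. Qed.

Lemma zoom_continuous (Z : topologicalType) (l : Z -> R) (s : Z -> 'rV[R]_n) :
  continuous l -> continuous s -> continuous (fun z => zoom (l z) (s z)).
Proof.
move=> cl cs; apply: mx_continuous => i j.
have -> : (fun z => zoom (l z) (s z) i j) =
    (fun z => l z * (s z i j - 2^-1) + 2^-1).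
  by apply/funext => z; rewrite !mxE.
have cij : continuous (fun z => s z i j : R).
  exact: (comp_continuous cs (@coord_continuous _ _ _ _ _)).
by cont.
Qed.

(** In the supremum norm, the cube is the ball of radius 1/2 about its
    centre. *)
Lemma zoom_out l s : 0 <= l -> 1 <= 2 * l * center_dist s ->
  ~ open_cube (zoom l s).
Proof.
move=> l0 lr; have [|i si] := @center_dist_max _ _ s.
  by rewrite lt_neqAle normr_ge0 andbT; apply: contraPneq lr => <-; lra.
move=> /(_ i); rewrite !mxE => /andP[s0 s1]; move: lr; rewrite -si.
by case: (ler0P (s ord0 i - 2^-1)) => _ h; nra.
Qed.

End Zoom.

Section FreeHomotopy.
Context (R : realType) (X : topologicalType) (n : nat).
Implicit Types (s : 'rV[R]_n) (g : R -> X) (f : 'rV[R]_n -> X).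

(** The homotopy runs from f0 to f1 while the base point follows g.  The values
    at all times, not only in [0, 1], are prescribed off the cube: this is
    no restriction for the homotopies that occur, and avoids clamping. *)
Definition free_homotopy g f1 f0 : Prop :=
  exists F : R * 'rV[R]_n -> X, [/\ continuous F,
    forall s, F (0, s) = f0 s, forall s, F (1, s) = f1 s &
    forall t s, ~ open_cube s -> F (t, s) = g t].

Lemma free_homotopy_cat g g' f1 f f0 :
  free_homotopy g f f0 -> free_homotopy g' f1 f ->
  free_homotopy (route_cat g g') f1 f0.
Proof.
case=> [F [cF F0 F1 Fg]] [F' [cF' F'0 F'1 F'g]].
exists (fun z => if z.1 - 2^-1 <= 0 then F (2 * z.1, z.2)
                 else F' (2 * z.1 - 1, z.2)); split=> [|s|s|t s ns] /=.
- apply: paste_continuous; first by cont.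
  + by apply: (comp_continuous _ cF); cont.
  + by apply: (comp_continuous _ cF'); cont.
  + move=> [t s] /= tE; have -> : 2 * t = 1 by lra.
    by rewrite subrr F1 F'0.
- by rewrite ifT ?mulr0 ?F0//; lra.
- by rewrite ifF; [rewrite -F'1; congr (F' (_, _)); lra|apply/negP; lra].
- by rewrite Fg// F'g.
Qed.

Lemma free_homotopy_rev g f1 f0 :
  free_homotopy g f1 f0 -> free_homotopy (route_rev g) f0 f1.
Proof.
case=> [F [cF F0 F1 Fg]]; exists (fun z => F (1 - z.1, z.2)).
split=> [|s|s|t s ns] /=; rewrite ?subr0 ?subrr ?F0 ?F1 ?Fg//.
by apply: (comp_continuous _ cF); cont.
Qed.

(** At time t, the map f is squeezed into the cube shrunk by the factor
    1 + |1 - t|; this factor is 1 at time 1 and 2 at time 0. *)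
Definition zoom_factor (t : R) : R := 1 - Num.min (1 - t) (t - 1).

(** Position of a point at distance r of the centre with respect to the shrunk
    cube: negative inside, 0 on its boundary, and at least |1 - t| once the
    point is out of the full cube. *)
Definition shell_pos (t r : R) : R := 2 * zoom_factor t * r - 1.

(** With e the position in the shell, 1 - t is truncated to [- e, e]: the path
    is therefore read at time 1 on the boundary of the shrunk cube and at time
    t off the full cube, for t on either side of 1. *)
Definition shell_time (t r : R) : R :=
  1 + Num.min (shell_pos t r) (- Num.min (1 - t) (shell_pos t r)).

(** The explicit free homotopy along g that ends at f.  Its value at time 0 is
    the transport of f along g: f on the inner cube, g along the radii of the
    shell.  For a loop g this is the action of pi_1 in radial form. *)
Definition transport_fun g f (z : R * 'rV[R]_n) : X :=
  if shell_pos z.1 (center_dist z.2) <= 0 then f (zoom (zoom_factor z.1) z.2)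
  else g (shell_time z.1 (center_dist z.2)).

Lemma zoom_factor_ge1 t : 1 <= zoom_factor t.
Proof. by rewrite /zoom_factor minEle; case: ifP; lra. Qed.

Lemma shell_time_inner t r : shell_pos t r = 0 -> shell_time t r = 1.
Proof.
by rewrite /shell_time => ->; rewrite !minEle; do 2 case: ifP; lra.
Qed.

Lemma shell_time_outer t r : 2^-1 <= r -> shell_time t r = t.
Proof.
move=> r2; have h : zoom_factor t - 1 <= shell_pos t r.
  by have := zoom_factor_ge1 t; rewrite /shell_pos; nra.
have := h; rewrite /shell_time /zoom_factor !minEle.
by repeat case: ifP => /=; lra.
Qed.

Lemma shell_pos_out t s : 0 <= shell_pos t (center_dist s) ->
  ~ open_cube (zoom (zoom_factor t) s).
Proof.
rewrite /shell_pos => h; apply: zoom_out; last by lra.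
by have := zoom_factor_ge1 t; lra.
Qed.

Lemma zoom_factor_continuous : continuous zoom_factor.
Proof. by rewrite /zoom_factor; cont. Qed.

(** The path and the map may vary with a parameter z, as needed to see that the
    transport of homotopic maps are homotopic. *)
Lemma transport_continuous (Z : topologicalType) (g : Z -> R -> X)
    (f : Z -> 'rV[R]_n -> X) (t : Z -> R) (s : Z -> 'rV[R]_n) :
  continuous t -> continuous s ->
  (forall r : Z -> R, continuous r -> continuous (fun z => g z (r z))) ->
  (forall u : Z -> 'rV[R]_n, continuous u -> continuous (fun z => f z (u z))) ->
  (forall z u, ~ open_cube u -> f z u = g z 1) ->
  continuous (fun z => transport_fun (g z) (f z) (t z, s z)).
Proof.
move=> ct cs cg cf fg.
have cl := comp_continuous ct zoom_factor_continuous.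
have cr := comp_continuous cs (@center_dist_continuous R n).
have cp : continuous (fun z => shell_pos (t z) (center_dist (s z))).
  by rewrite /shell_pos; cont.
apply: paste_continuous => //=.
- by apply: cf; apply: zoom_continuous.
- by apply: cg; rewrite /shell_time; cont.
- move=> z h; rewrite shell_time_inner// fg//.
  by apply: shell_pos_out; rewrite h.
Qed.

End FreeHomotopy.

Lemma hclass_ext (R : realType) (X : topologicalType) n (x : X)
  (f f' : nloop R n x) : f =1 f' -> hclass f = hclass f'.
Proof.
move=> ff'; apply/hclassP; have /funext -> := ff'.
exact/homotopic_refl/nloop_continuous.
Qed.

Section Transport.
Context (R : realType) (X : topologicalType) (n : nat).
Implicit Types x y : X.
Let out := ~` @open_cube R n.

Lemma route_transport_continuous x y (g : route R x y) (f : nloop R n y)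
    (Z : topologicalType) (t : Z -> R) (s : Z -> 'rV[R]_n) :
  continuous t -> continuous s ->
  continuous (fun z => transport_fun g f (t z, s z)).
Proof.
move=> ct cs; apply: (@transport_continuous _ _ _ _ (fun=> g) (fun=> f)) => //.
- by move=> r cr; exact: (comp_continuous cr (@route_continuous _ _ _ _ g)).
- by move=> u cu; exact: (comp_continuous cu (@nloop_continuous _ _ _ _ f)).
- by move=> z u nu; rewrite nloop_base// route1.
Qed.

Lemma transport_funE x y (g : route R x y) (f : nloop R n y) t s :
  ~ open_cube s -> transport_fun g f (t, s) = g t.
Proof.
move=> ns; have r2 := center_dist_out ns; rewrite /transport_fun /=.
rewrite shell_time_outer//; case: ifP => // h.
have l1 := zoom_factor_ge1 t; move: (h); rewrite /shell_pos => h'.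
have r2' : center_dist s = 2^-1 by nra.
have l1' : zoom_factor t = 1 by nra.
have -> : t = 1 by move: l1'; rewrite /zoom_factor minEle; case: ifP; lra.
have -> : zoom_factor 1 = 1 :> R by rewrite /zoom_factor minEle; case: ifP; lra.
by rewrite zoom1 nloop_base// route1.
Qed.

Lemma transport_fun1 x y (g : route R x y) (f : nloop R n y) s :
  transport_fun g f (1, s) = f s.
Proof.
have [s_in|s_out] := pselect (open_cube s); last first.
  by rewrite transport_funE// route1 nloop_base.
have l1 : zoom_factor 1 = 1 :> R by rewrite /zoom_factor minEle; case: ifP; lra.
rewrite /transport_fun /= l1 zoom1 /shell_pos l1 ifT//.
rewrite leNgt; apply/negP => h; case: (@zoom_out _ _ 1 s) => //; first by lra.
by rewrite zoom1.
Qed.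

Lemma transport_nloop_continuous x y (g : route R x y) (f : nloop R n y) :
  continuous (fun s => transport_fun g f (0, s)).
Proof.
by apply: route_transport_continuous; [exact: const_continuous|exact: id_continuous].
Qed.

Lemma transport_nloop_base x y (g : route R x y) (f : nloop R n y) s :
  ~ open_cube s -> transport_fun g f (0, s) = x.
Proof. by move=> ns; rewrite transport_funE// route0. Qed.

Definition transport_nloop x y (g : route R x y) (f : nloop R n y) : nloop R n x :=
  NLoop (@transport_nloop_continuous _ _ g f) (@transport_nloop_base _ _ g f).

Lemma transport_nloop_free x y (g : route R x y) (f : nloop R n y) :
  free_homotopy g f (transport_nloop g f).
Proof.
exists (transport_fun g f); split=> // [|s|t s].
- rewrite (_ : transport_fun _ _ = (fun z => transport_fun g f (z.1, z.2))).
    by apply: route_transport_continuous; [exact: fst_continuous|exact: snd_continuous].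
  by apply/funext => -[].
- exact: transport_fun1.
- exact: transport_funE.
Qed.

Lemma transport_nloop_homotopic x y (g : route R x y) (f f' : nloop R n y) :
  homotopic R out f f' ->
  homotopic R out (transport_nloop g f) (transport_nloop g f').
Proof.
case/homotopic_clamp => H [cH H0 H1 HA].
exists (fun z => transport_fun g (fun u => H (z.1, u)) (0, z.2)).
split=> [|s|s|t s t01 ns] /=.
- apply: (@transport_continuous _ _ _ _ (fun=> g) (fun z u => H (z.1, u))) => //.
  + exact: const_continuous.
  + exact: snd_continuous.
  + by move=> r cr; exact: (comp_continuous cr (@route_continuous _ _ _ _ g)).
  + move=> u cu; apply: (comp_continuous _ cH).
    by apply: pair_continuous => //; exact: fst_continuous.
  + by move=> z u nu; rewrite HA// nloop_base// route1.
- by congr (transport_fun _ _ _); apply/funext => u.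
- by congr (transport_fun _ _ _); apply/funext => u.
- rewrite /transport_fun /=; case: ifP => // h.
  rewrite HA//; apply: zoom_out; first by have := @zoom_factor_ge1 R 0; lra.
  by have := @zoom_factor_ge1 R 0; have := center_dist_out ns; nra.
Qed.

(** Any free homotopy F along g from f0 to f computes the transport of f.
    At time u, put the stage of F at time u in the cube shrunk by 1 + u, and run
    through the path g up to time u in the remaining shell.  Since F is equal to
    g off the cube, both are values of F at the zoomed point, at the smaller of
    u and the radial time 2 - 4 r, truncated to [0, 1]. *)
Lemma free_homotopy_transport x y (g : route R x y) (f : nloop R n y)
    (f0 : nloop R n x) :
  free_homotopy g f f0 -> homotopic R out (transport_nloop g f) f0.
Proof.
case=> F [cF F0 F1 Fg]; apply: homotopic_sym.
exists (fun z => F (Num.min z.1 (clamp (2 - 4 * center_dist z.2)), zoom (1 + z.1) z.2)).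
have cr := comp_continuous (@snd_continuous R _) (@center_dist_continuous R n).
have l2 : zoom_factor 0 = 2 :> R by rewrite /zoom_factor minEle; case: ifP; lra.
split=> [|s|s|t s /andP[t0 t1] ns] /=.
- apply: (comp_continuous _ cF); apply: pair_continuous; rewrite /clamp; cont.
  by apply: zoom_continuous; cont.
- rewrite addr0 zoom1 -F0; congr (F (_, _)).
  by rewrite /clamp !minEle; repeat case: ifP; lra.
- rewrite /transport_fun /= l2 /shell_pos l2; case: ifP => h.
    rewrite -F1; congr (F (_, zoom _ _)).
    by rewrite /clamp !minEle; repeat case: ifP; lra.
  rewrite Fg; last by apply: zoom_out => //; lra.
  congr (g _); rewrite /shell_time /shell_pos l2 /clamp !minEle.
  by repeat case: ifP; lra.
- have r2 := center_dist_out ns; rewrite [RHS]nloop_base//.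
  rewrite (_ : Num.min _ _ = 0).
    by rewrite Fg ?route0//; apply: zoom_out; nra.
  by rewrite /clamp !minEle; repeat case: ifP; lra.
Qed.

Definition transport x y (g : route R x y) (a : homotopy_group R n y) :
  homotopy_group R n x := hclass (transport_nloop g (repr a)).

Lemma transportE x y (g : route R x y) (f : nloop R n y) :
  transport g (hclass f) = hclass (transport_nloop g f).
Proof. by apply/hclassP/transport_nloop_homotopic; exact: hclassK. Qed.

Lemma transportP x y (g : route R x y) (f : nloop R n y) (f0 : nloop R n x) :
  free_homotopy g f f0 -> transport g (hclass f) = hclass f0.
Proof. by move=> gf; rewrite transportE; apply/hclassP/free_homotopy_transport. Qed.

(** For a loop, the explicit formulas of the transport and of the action
    agree point by point. *)
Lemma transport_loop x (g : route R x x) (a : homotopy_group R n x) :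
  transport g a = pi1_act (hclass (route_loop g)) a.
Proof.
rewrite -[a]hclass_repr transportE pi1_actE; apply: hclass_ext => s /=.
have l2 : zoom_factor 0 = 2 :> R by rewrite /zoom_factor minEle; case: ifP; lra.
rewrite /transport_fun /act_fun /= /shell_time /shell_pos l2 zoom2 mxE.
have -> : (2 * 2 * center_dist s - 1 <= 0) = (center_dist s - 4^-1 <= 0).
  by apply/idP/idP; lra.
case: ifP => // h; congr (g _); rewrite /clamp !minEle.
by repeat case: ifP; lra.
Qed.

Lemma pi1_act_transport x (c : nloop R 1 x) (a : homotopy_group R n x) :
  pi1_act (hclass c) a = transport (loop_route c) a.
Proof.
rewrite transport_loop; congr (pi1_act _ _).
by apply: hclass_ext => s; rewrite loop_routeK.
Qed.

Lemma transport_cat x y z (g : route R x y) (g' : route R y z)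
    (a : homotopy_group R n z) :
  transport (cat_route g g') a = transport g (transport g' a).
Proof.
rewrite -[a]hclass_repr (transportE g') (transportE g); apply: transportP.
by apply: free_homotopy_cat; exact: transport_nloop_free.
Qed.

Lemma transport_rev x y (g : route R x y) (a : homotopy_group R n y) :
  transport (rev_route g) (transport g a) = a.
Proof.
rewrite -[a]hclass_repr (transportE g); apply: transportP.
exact/free_homotopy_rev/transport_nloop_free.
Qed.

Lemma transport_ext x y (g g' : route R x y) (a : homotopy_group R n y) :
  g =1 g' -> transport g a = transport g' a.
Proof.
move=> /funext gg'; rewrite -[a]hclass_repr (transportE g'); apply: transportP.
by rewrite gg'; exact: transport_nloop_free.
Qed.

End Transport.

(** * Naturality and additivity of the transport *)

Section Functoriality.
Context (R : realType) (X Y : topologicalType) (k : X -> Y) (ck : continuous k).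

Lemma free_homotopy_map n (g : R -> X) (f f0 : 'rV[R]_n -> X) :
  free_homotopy g f f0 -> free_homotopy (k \o g) (k \o f) (k \o f0).
Proof.
case=> F [cF F0 F1 Fg]; exists (k \o F); split=> [|s|s|t s ns] /=.
- exact: comp_continuous cF ck.
- by rewrite F0.
- by rewrite F1.
- by rewrite Fg.
Qed.

Lemma pi_map_transport n x y (g : route R x y) (a : homotopy_group R n y) :
  pi_map ck (transport g a) = transport (map_route ck g) (pi_map ck a).
Proof.
rewrite -[a]hclass_repr transportE !pi_mapE; symmetry; apply: transportP.
exact/free_homotopy_map/transport_nloop_free.
Qed.

Lemma pi_map_act n x (c : homotopy_group R 1 x) (a : homotopy_group R n x) :
  pi_map ck (pi1_act c a) = pi1_act (pi_map ck c) (pi_map ck a).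
Proof.
rewrite -[c]hclass_repr -[a]hclass_repr pi1_actE !pi_mapE pi1_actE.
by apply: hclass_ext => s /=; rewrite /act_fun; case: ifP.
Qed.

Lemma pi_map_mul n x (a b : homotopy_group R n.+1 x) :
  pi_map ck (a * b)%g = (pi_map ck a * pi_map ck b)%g.
Proof.
rewrite -[a]hclass_repr -[b]hclass_repr [(_ * _)%g in LHS]pi_mulE !pi_mapE.
rewrite [RHS]pi_mulE.
by apply: hclass_ext => s /=; rewrite /concat_fun; case: ifP.
Qed.

Lemma pi_map_one n x : pi_map ck (1 : homotopy_group R n.+1 x)%g = 1%g.
Proof. by rewrite [LHS]pi_mapE; exact: hclass_ext. Qed.

Lemma pi_map_exp n x (a : homotopy_group R n.+1 x) m :
  pi_map ck (a ^+ m)%g = (pi_map ck a ^+ m)%g.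
Proof.
elim: m => [|m IHm]; first by rewrite !expg0 pi_map_one.
by rewrite !expgS pi_map_mul IHm.
Qed.

End Functoriality.

Lemma free_homotopy_cst (R : realType) (X : topologicalType) n (g : R -> X) :
  continuous g -> free_homotopy g (fun _ : 'rV[R]_n => g 1) (fun=> g 0).
Proof.
move=> cg; exists (fun z => g z.1); split=> //.
exact: comp_continuous (@fst_continuous _ _) cg.
Qed.

Section Action.
Context (R : realType) (X : topologicalType) (n : nat).
Implicit Types x : X.

Lemma pi1_act_mull x (c d : homotopy_group R 1 x) (a : homotopy_group R n x) :
  pi1_act (c * d)%g a = pi1_act c (pi1_act d a).
Proof.
rewrite -[c]hclass_repr -[d]hclass_repr [(_ * _)%g]pi_mulE !pi1_act_transport.
rewrite -transport_cat; apply: transport_ext => t /=.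
rewrite /concat_fun /route_cat mxE.
have cE (b : R) : set_coord0 b (const_mx t : 'rV_1) = const_mx b.
  by apply/rowP => i; rewrite !mxE (ord1 i).
by rewrite !cE.
Qed.

Lemma pi1_act1 x (a : homotopy_group R n x) : pi1_act 1%g a = a.
Proof.
rewrite [LHS]pi1_act_transport -[a]hclass_repr; apply: transportP.
exists (fun z => repr a z.2); split=> // [|t s ns] /=; last by rewrite nloop_base.
apply: (comp_continuous (@snd_continuous _ _)); exact: nloop_continuous.
Qed.

End Action.

Section TransportGroup.
Context (R : realType) (X : topologicalType) (n : nat).
Implicit Types x y : X.

Lemma free_homotopy_concat (g : R -> X) (f f' f0 f0' : 'rV[R]_n.+1 -> X) :
  free_homotopy g f f0 -> free_homotopy g f' f0' ->
  free_homotopy g (concat_fun f f') (concat_fun f0 f0').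
Proof.
case=> F [cF F0 F1 Fg] [F' [cF' F'0 F'1 F'g]].
exists (fun z : R * 'rV[R]_n.+1 =>
  concat_fun (fun s => F (z.1, s)) (fun s => F' (z.1, s)) z.2).
have c2 : continuous (fun z : R * 'rV[R]_n.+1 => z.2 ord0 ord0 : R).
  exact: (comp_continuous (@snd_continuous _ _) (@coord0_continuous _ _)).
split=> [|s|s|t s ns] /=.
- apply: paste_continuous; first by cont.
  + apply: (comp_continuous _ cF); apply: pair_continuous; first exact: fst_continuous.
    by apply: set_coord0_continuous; cont.
  + apply: (comp_continuous _ cF'); apply: pair_continuous; first exact: fst_continuous.
    by apply: set_coord0_continuous; cont.
  + by move=> [t s] /= s0; rewrite Fg ?F'g// => /(_ ord0); rewrite set_coord00; lra.
- by rewrite /concat_fun F0 F'0.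
- by rewrite /concat_fun F1 F'1.
- rewrite /concat_fun; case: ifP => h; [rewrite Fg|rewrite F'g] => //;
    by apply: set_coord0_out => // hs; move: h; lra.
Qed.

Lemma transport_mul x y (g : route R x y) (a b : homotopy_group R n.+1 y) :
  transport g (a * b)%g = (transport g a * transport g b)%g.
Proof.
rewrite -[a]hclass_repr -[b]hclass_repr [(_ * _)%g in LHS]pi_mulE.
rewrite (transportE g (repr a)) (transportE g (repr b)) [RHS]pi_mulE.
apply: transportP.
by apply: free_homotopy_concat; exact: transport_nloop_free.
Qed.

Lemma transport_one x y (g : route R x y) :
  transport g (1 : homotopy_group R n.+1 y)%g = 1%g.
Proof.
have := @free_homotopy_cst _ _ n.+1 g (@route_continuous _ _ _ _ g).
rewrite route0 route1 => h.
exact: (@transportP _ _ _ _ _ g (const_nloop _ _) (const_nloop _ _) h).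
Qed.

Lemma transport_exp x y (g : route R x y) (a : homotopy_group R n.+1 y) m :
  transport g (a ^+ m)%g = (transport g a ^+ m)%g.
Proof.
elim: m => [|m IHm]; first by rewrite !expg0 transport_one.
by rewrite !expgS transport_mul IHm.
Qed.

Lemma pi1_act_one x (c : homotopy_group R 1 x) :
  pi1_act c (1 : homotopy_group R n.+1 x)%g = 1%g.
Proof. by rewrite -[c]hclass_repr pi1_act_transport transport_one. Qed.

(** The action is by group automorphisms and multiplicative in the loop. *)
Lemma pi1_act_fix_exp x (c : homotopy_group R 1 x)
    (a : homotopy_group R n.+1 x) i j :
  pi1_act c a = a -> pi1_act (c ^+ i)%g (a ^+ j)%g = (a ^+ j)%g.
Proof.
move=> ca; have {ca} : pi1_act c (a ^+ j)%g = (a ^+ j)%g.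
  by move: ca; rewrite -[c]hclass_repr !pi1_act_transport transport_exp => ->.
move: (a ^+ j)%g => b cb; elim: i => [|i IHi]; first by rewrite expg0 pi1_act1.
by rewrite expgS pi1_act_mull IHi.
Qed.

End TransportGroup.

Lemma pi_map_comp (R : realType) (X Y Z : topologicalType) (k : X -> Y)
    (l : Y -> Z) (ck : continuous k) (cl : continuous l)
    (clk : continuous (fun x => l (k x))) n x (a : homotopy_group R n x) :
  pi_map clk a = pi_map cl (pi_map ck a).
Proof. by rewrite -[a]hclass_repr !pi_mapE; exact: hclass_ext. Qed.

Lemma transport_factor (R : realType) (X Y Z : topologicalType) (s : X -> Y)
    (k : Y -> Z) (l : X -> Z) (cs : continuous s) (ck : continuous k)
    (cl : continuous l) (kl : forall x, k (s x) = l x) n x z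
    (g : route R z (k (s x))) (u : homotopy_group R n x) :
  transport g (pi_map ck (pi_map cs u)) =
  transport (cast_route erefl (kl x) g) (pi_map cl u).
Proof.
rewrite -[u]hclass_repr !pi_mapE !transportE; apply: hclass_ext => v /=.
by rewrite /transport_fun /=; case: ifP.
Qed.

(** * Families of maps that are jointly an equivalence *)

Lemma ptws_continuous (Z T : topologicalType) (I : Type) (f : Z -> {ptws I -> T}) :
  (forall i, continuous (fun z => f z i)) -> continuous f.
Proof.
move=> cf z; apply/cvg_sup => i.
move=> A [B [[C oC <-] Cz] BA]; apply: filterS BA _.
by apply: (cf i z); exact: open_nbhs_nbhs.
Qed.

Lemma ptws_proj_continuous (T : topologicalType) (I : eqType) (i : I) :
  continuous (fun f : {ptws I -> T} => f i).
Proof. exact: (@proj_continuous _ (fun=> T) i). Qed.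

(** The Segal condition in terms of components: maps r i that are jointly a weak
    equivalence to a power let one compute in the homotopy groups of X one
    component at a time. *)
Section JointEquivalence.
Context (R : realType) (X Y : topologicalType) (I : eqType).
Context (r : I -> X -> Y) (cr : forall i, continuous (r i)).
Context (weq_r : weak_equivalence R (fun x => (r^~ x : {ptws I -> Y}))).

Lemma joint_pi_inj n x (a b : homotopy_group R n.+1 x) :
  (forall i, pi_map (@cr i) a = pi_map (@cr i) b) -> a = b.
Proof.
move=> ab; apply: (bij_inj (weq_pi_bij weq_r n x)); move: ab.
rewrite -[a]hclass_repr -[b]hclass_repr => ab; rewrite !pi_mapE; apply/hclassP.
have {ab} : forall i, homotopic R (~` @open_cube R n.+1)
    (r i \o repr a) (r i \o repr b).
  by move=> i; move: (ab i); rewrite !pi_mapE => /hclassP.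
move=> /choice[H HP]; exists (fun z => H^~ z); split=> [|s|s|t s t01 ns].
- by apply: ptws_continuous => i; case: (HP i).
- by apply/funext => i; case: (HP i) => _ ->.
- by apply/funext => i; case: (HP i) => _ _ ->.
- by apply/funext => i; case: (HP i) => _ _ _ ->.
Qed.

Lemma joint_pi_surj n x (b : forall i, homotopy_group R n.+1 (r i x)) :
  exists a, forall i, pi_map (@cr i) a = b i.
Proof.
have cf : continuous (fun s => (fun i => repr (b i) s) : {ptws I -> Y}).
  by apply: ptws_continuous => i; exact: nloop_continuous.
have fx s : ~ open_cube s -> (fun i => repr (b i) s) = r^~ x.
  by move=> ns; apply/funext => i; rewrite nloop_base.
pose f : nloop R n.+1 (r^~ x : {ptws I -> Y}) := NLoop cf fx.
have [k _ kK] := weq_pi_bij weq_r n x.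
exists (k (hclass f)) => i; move: (kK (hclass f)).
rewrite -[k _]hclass_repr pi_mapE => /hclassP[H [cH H0 H1 HA]].
rewrite pi_mapE -[RHS]hclass_repr; apply/hclassP; exists (fun z => H z i).
split=> [|s|s|t s t01 ns] /=.
- exact: (comp_continuous cH (@ptws_proj_continuous _ _ i)).
- by rewrite H0.
- by rewrite H1.
- by rewrite HA.
Qed.

Lemma joint_route x x' : (forall i, route R (r i x) (r i x')) ->
  exists g : route R x x', True.
Proof.
move=> g; have : path_connected R (r^~ x : {ptws I -> Y}) (r^~ x').
  exists (fun t => (fun i => g i t) : {ptws I -> Y}).
  split; first by apply: ptws_continuous => i; exact: route_continuous.
    by apply/funext => i; rewrite route0.
  by apply/funext => i; rewrite route1.
by move=> /(weq_pi0_inj weq_r)[d [cd d0 d1]]; exists (Route cd d0 d1).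
Qed.

(** A family of paths between the components of two points lifts to a path
    between the points, up to homotopy relative to the end points.  Only the
    effect on transports matters here: any path d0 between the points is
    corrected by a loop c, whose components compare the paths L i with the
    components of d0. *)
Lemma joint_route_lift x x' (L : forall i, route R (r i x) (r i x')) :
  exists d : route R x x', forall n (a : homotopy_group R n.+1 x')
      (b : homotopy_group R n.+1 x),
    (forall i, transport (L i) (pi_map (@cr i) a) = pi_map (@cr i) b) ->
    transport d a = b.
Proof.
have [d0 _] := joint_route L.
have [c cP] := joint_pi_surj (fun i =>
  hclass (route_loop (cat_route (L i) (rev_route (map_route (@cr i) d0))))).
exists (cat_route (loop_route (repr c)) d0) => n a b ab.
rewrite transport_cat -pi1_act_transport hclass_repr.
apply: joint_pi_inj => i.
by rewrite pi_map_act cP -transport_loop transport_cat pi_map_transport transport_rev.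
Qed.

End JointEquivalence.

(** * The Frobenius on homotopy groups *)

(** The inverse makes the k-th component of the permuted point the component
    of index t k. *)
Definition pmap_perm n (t : {perm 'I_n}) : pmap_fin n n :=
  [ffun i => Some ((t^-1)%g i)].

Lemma gamma_rho_perm (M : gamma_space) n (t : {perm 'I_n}) k (x : M n) :
  gamma_map (pmap_rho k) (gamma_map (pmap_perm t) x) =
  gamma_map (pmap_rho (t k)) x.
Proof.
rewrite -gamma_comp; congr (gamma_map _ x); apply/ffunP => i; rewrite !ffunE /=.
by rewrite ffunE -(inj_eq (@perm_inj _ t)) permKV.
Qed.

Lemma gamma_fold_perm (M : gamma_space) n (t : {perm 'I_n}) (x : M n) :
  gamma_map (pmap_fold n) (gamma_map (pmap_perm t) x) =
  gamma_map (pmap_fold n) x.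
Proof.
by rewrite -gamma_comp; congr (gamma_map _ x); apply/ffunP => i; rewrite !ffunE /= ffunE.
Qed.

(** K is a homotopy from the components of the lift h to the diagonal of q,
    and fold o h represents the Frobenius. *)
Section Frobenius.
Context (R : realType) (p : nat) (M : comm_monoid R) (W : topologicalType).
Context (q : W -> M 1%N) (h : W -> M p) (ch : continuous h).
Context (K : R * W -> {ptws 'I_p -> M 1%N}) (cK : continuous K).
Context (K0 : forall w, K (0, w) = segal_map (h w)).
Context (K1 : forall w, K (1, w) = fun=> q w).

Let rho (i : 'I_p) : M p -> M 1%N := gamma_map (pmap_rho i).
Let crho i : continuous (rho i) := @gamma_continuous M p 1 (pmap_rho i).
Let fold : M p -> M 1%N := gamma_map (pmap_fold p).
Let cfold : continuous fold := @gamma_continuous M p 1 (pmap_fold p).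
Let weq_rho : weak_equivalence R (fun x => (rho^~ x : {ptws 'I_p -> M 1%N})) :=
  comm_monoid_segal M p.

Lemma diagonal_route_continuous k w : continuous (fun t : R => K (t, w) k).
Proof.
apply: (comp_continuous (comp_continuous _ cK) (@ptws_proj_continuous _ _ k)).
by cont.
Qed.

Lemma diagonal_route0 k w : K (0, w) k = rho k (h w).
Proof. by rewrite K0. Qed.

Lemma diagonal_route1 k w : K (1, w) k = q w.
Proof. by rewrite K1. Qed.

Definition diagonal_route k w : route R (rho k (h w)) (q w) :=
  Route (@diagonal_route_continuous k w) (diagonal_route0 k w) (diagonal_route1 k w).

Definition component_route k l w : route R (rho k (h w)) (rho l (h w)) :=
  cat_route (diagonal_route k w) (rev_route (diagonal_route l w)).

(** All the components of h_*(a) are freely homotopic to q_*(a), along the paths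
    that join the base points to q w. *)
Lemma component_transport k l n w (a : homotopy_group R n w) :
  transport (component_route k l w) (pi_map (@crho l) (pi_map ch a)) =
  pi_map (@crho k) (pi_map ch a).
Proof.
have diag i (f : nloop R n w) :
    free_homotopy (diagonal_route i w) (q \o f) (rho i \o (h \o f)).
  exists (fun z => K (z.1, f z.2) i); split=> [|s|s|t s ns] /=.
  - apply: (comp_continuous (comp_continuous _ cK) (@ptws_proj_continuous _ _ i)).
    cont; apply: comp_continuous (@snd_continuous _ _) _.
    exact: nloop_continuous.
  - by rewrite K0.
  - by rewrite K1.
  - by rewrite nloop_base.
rewrite -[a]hclass_repr !pi_mapE; apply: transportP.
by apply: free_homotopy_cat; [exact: diag|exact/free_homotopy_rev/diag].
Qed.

(** The loop is the image under the addition of a path in M<p> from h w to the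
    permuted point, which lifts the component paths.  It is closed because the
    addition is invariant under permutations.  Transport along the path takes
    the permutation of u to v as soon as it does so on components, and the
    addition forgets the permutation of u. *)
Lemma permutation_loop (t : {perm 'I_p}) w :
  exists c : homotopy_group R 1 (fold (h w)),
    forall n (u v : homotopy_group R n.+1 (h w)),
    (forall k, transport (component_route k (t k) w) (pi_map (@crho (t k)) u) =
       pi_map (@crho k) v) ->
    pi1_act c (pi_map cfold u) = pi_map cfold v.
Proof.
have cs := @gamma_continuous M p p (pmap_perm t).
have [d dP] := @joint_route_lift _ _ _ _ rho crho weq_rho (h w) _ (fun k =>
  cast_route erefl (esym (gamma_rho_perm t k (h w))) (component_route k (t k) w)).
exists (hclass (route_loop (cast_route erefl (gamma_fold_perm t (h w))
  (map_route cfold d)))) => n u v uv.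
rewrite -transport_loop -(transport_factor cs cfold) -pi_map_transport.
congr (pi_map _ _); apply: dP => k; rewrite -uv.
rewrite (transport_factor cs _ (@crho (t k)) (gamma_rho_perm t k)).
exact: transport_ext.
Qed.

Context (weq_phi : weak_equivalence R (fun w => fold (h w))).
Context (w : W).
Let y := h w.
Let phi n (a : homotopy_group R n.+1 w) : homotopy_group R n.+1 (fold y) :=
  pi_map cfold (pi_map ch a).

Lemma phi_bij n : bijective (@phi n).
Proof.
apply: (eq_bij (weq_pi_bij weq_phi n w)) => a; exact: pi_map_comp.
Qed.

(** Every class is some phi_*(a), and the family h_*(a) corresponds to its own
    permutation, since all its components come from a. *)
Lemma permutation_loop_central (t : {perm 'I_p}) :
  exists c : homotopy_group R 1 (fold y),
   (forall n (x : homotopy_group R n.+1 (fold y)), pi1_act c x = x) /\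
    forall n (u v : homotopy_group R n.+1 y),
    (forall k, transport (component_route k (t k) w) (pi_map (@crho (t k)) u) =
       pi_map (@crho k) v) ->
    pi1_act c (pi_map cfold u) = pi_map cfold v.
Proof.
have [c cP] := permutation_loop t w; exists c; split=> // n x.
have [k _ kK] := phi_bij n; rewrite -[x]kK; apply: cP => i.
exact: component_transport.
Qed.

Lemma inj_component_ex i n (a : homotopy_group R n.+1 w) :
  exists u : homotopy_group R n.+1 y, forall k,
    pi_map (@crho k) u = if k == i then pi_map (@crho k) (pi_map ch a) else 1%g.
Proof. exact: (@joint_pi_surj _ _ _ _ _ crho weq_rho n y). Qed.

Definition inj_component i n (a : homotopy_group R n.+1 w) :
  homotopy_group R n.+1 y := sval (cid (inj_component_ex i a)).

Lemma rho_inj_component i n (a : homotopy_group R n.+1 w) k :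
  pi_map (@crho k) (inj_component i a) =
  if k == i then pi_map (@crho k) (pi_map ch a) else 1%g.
Proof. exact: (svalP (cid (inj_component_ex i a))). Qed.

(** This is a translated by the p - 1 components of h w of index other
    than i. *)
Definition summand i n (a : homotopy_group R n.+1 w) :=
  pi_map cfold (inj_component i a).

(** The loop of the transposition of i and j carries one summand to the other,
    but it acts trivially. *)
Lemma summand_eq i j n (a : homotopy_group R n.+1 w) : summand i a = summand j a.
Proof.
have [c [c_id cP]] := permutation_loop_central (tperm i j).
rewrite -[LHS]c_id; apply: cP => k; rewrite !rho_inj_component.
case: tpermP => [->|->|/eqP ki /eqP kj].
- rewrite eq_sym; case: ifP => [/eqP ij|_]; last by rewrite transport_one.
  by rewrite component_transport.
- by rewrite !eqxx component_transport.
- by rewrite (negbTE ki) (negbTE kj) transport_one.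
Qed.

Lemma summand_mul i n (a b : homotopy_group R n.+1 w) :
  summand i (a * b)%g = (summand i a * summand i b)%g.
Proof.
rewrite -pi_map_mul; congr (pi_map _ _).
apply: (joint_pi_inj weq_rho) => k.
rewrite pi_map_mul !rho_inj_component; case: ifP; last by rewrite mul1g.
by rewrite !pi_map_mul.
Qed.

Lemma summand_commute i j n (a b : homotopy_group R n.+1 w) : i != j ->
  (summand i a * summand j b = summand j b * summand i a)%g.
Proof.
move=> ij; rewrite -!pi_map_mul; congr (pi_map _ _).
apply: (joint_pi_inj weq_rho) => k; rewrite !pi_map_mul !rho_inj_component.
by have [->|_] := eqVneq k i; rewrite ?(negbTE ij) !(mulg1, mul1g).
Qed.

Lemma summand_act i j n (c : homotopy_group R 1 w) (a : homotopy_group R n.+1 w) :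
  i != j -> pi1_act (summand i c) (summand j a) = summand j a.
Proof.
move=> ij; rewrite -pi_map_act; congr (pi_map _ _).
apply: (joint_pi_inj weq_rho) => k; rewrite pi_map_act !rho_inj_component.
by have [->|_] := eqVneq k i; rewrite ?(negbTE ij) ?pi1_act_one ?pi1_act1.
Qed.

(** h_*(a) is the product of its components, placed one by one; each of them
    contributes the same summand. *)
Lemma phi_summand i n (a : homotopy_group R n.+1 w) :
  phi a = (summand i a ^+ p)%g.
Proof.
have partial_sum m : (m <= p)%N -> exists2 u : homotopy_group R n.+1 y,
    (forall k, pi_map (@crho k) u =
       if (k < m)%N then pi_map (@crho k) (pi_map ch a) else 1%g) &
    pi_map cfold u = (summand i a ^+ m)%g.
  elim: m => [_|m IHm mp].
    by exists 1%g => [k|]; rewrite ?pi_map_one ?expg0.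
  have [u uP fu] := IHm (ltnW mp).
  exists (u * inj_component (Ordinal mp) a)%g => [k|]; last first.
    by rewrite pi_map_mul fu expgSr (summand_eq i (Ordinal mp)).
  rewrite pi_map_mul uP rho_inj_component [in RHS]ltnS [in RHS]leq_eqVlt -val_eqE /=.
  by have [km|_] := eqVneq (val k) m; rewrite /= ?km ?ltnn ?mul1g ?mulg1.
have [u uP <-] := partial_sum p (leqnn p).
congr (pi_map _ _); apply: (joint_pi_inj weq_rho) => k.
by rewrite uP ltn_ord.
Qed.

Lemma phi_exp n (a : homotopy_group R n.+1 w) m : phi (a ^+ m)%g = (phi a ^+ m)%g.
Proof. by rewrite /phi !pi_map_exp. Qed.

Lemma summand_exp i n (a : homotopy_group R n.+1 w) m :
  summand i (a ^+ m)%g = (summand i a ^+ m)%g.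
Proof.
elim: m => [|m IHm]; last by rewrite !expgS summand_mul IHm.
by apply: (mulIg (summand i 1%g)); rewrite !expg0 -summand_mul !mul1g.
Qed.

Context (p_gt1 : (1 < p)%N).
Let i0 : 'I_p := Ordinal (ltnW p_gt1).
Let i1 : 'I_p := Ordinal p_gt1.

(** As the summands do not depend on the index, one may use index 0 for a and
    index 1 for b. *)
Lemma frobenius_commute (a b : homotopy_group R 1 (fold y)) : (a * b = b * a)%g.
Proof.
have [k _ kK] := phi_bij 0; rewrite -[a]kK -[b]kK.
rewrite (phi_summand i0) (phi_summand i1).
have := @summand_commute i0 i1 0 (k a) (k b) isT.
by move=> /commuteX2 ->.
Qed.

Lemma frobenius_act n (c : homotopy_group R 1 (fold y))
  (a : homotopy_group R n.+1 (fold y)) : pi1_act c a = a.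
Proof.
have [k _ kK] := phi_bij 0; have [l _ lK] := phi_bij n; rewrite -[a]lK -[c]kK.
by rewrite (phi_summand i0) (phi_summand i1) pi1_act_fix_exp ?summand_act.
Qed.

(** With phi_* invertible, the inverse of the p-th power map is the summand map
    composed with the inverse of phi_*. *)
Lemma frobenius_divisible n : uniquely_divisible p (homotopy_group R n.+1 (fold y)).
Proof.
have [k phiK kK] := phi_bij n; move=> a; exists (summand i0 (k a)).
split=> [|b <-]; first by rewrite -phi_summand kK.
by rewrite -[in LHS](kK b) -phi_exp phiK summand_exp -phi_summand kK.
Qed.

End Frobenius.

(** * All base points *)

Definition simple_divisible_at (R : realType) (p : nat) (X : topologicalType)
    (x : X) : Prop :=
  [/\ forall a b : homotopy_group R 1 x, (a * b)%g = (b * a)%g,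
      forall n (c : homotopy_group R 1 x) (a : homotopy_group R n.+1 x),
        pi1_act c a = a &
      forall n, uniquely_divisible p (homotopy_group R n.+1 x)].

(** Transport along g is an isomorphism of homotopy groups, and conjugation by g
    turns the action of a loop at y into that of a loop at x. *)
Lemma simple_divisible_route (R : realType) (p : nat) (X : topologicalType)
    (x y : X) (g : route R x y) :
  simple_divisible_at R p x -> simple_divisible_at R p y.
Proof.
have inj n : injective (@transport R X n x y g).
  exact: can_inj (transport_rev g).
case=> comm_x act_x div_x; split=> [a b|n c a|n a].
- by apply: inj; rewrite !transport_mul comm_x.
- rewrite -[c]hclass_repr pi1_act_transport; apply: inj.
  have := act_x n (hclass (route_loop (cat_route g
    (cat_route (loop_route (repr c)) (rev_route g))))) (transport g a).
  by rewrite -transport_loop !transport_cat transport_rev.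
- have [b [bP b_uniq]] := div_x n (transport g a).
  exists (transport (rev_route g) b); split.
    by rewrite -transport_exp bP transport_rev.
  move=> b' b'P; rewrite (b_uniq (transport g b')) ?transport_rev//.
  by rewrite -transport_exp b'P.
Qed.

Theorem theorem1 (R : realType) (p : nat) (p_prime : prime p)
    (M : comm_monoid R) (M_perfect : p_perfect p M) :
  simple_space R (underlying M) /\
  forall (n : nat) (m : underlying M),
    uniquely_divisible p (homotopy_group R n.+1 m).
Proof.
suff pt (m : underlying M) : simple_divisible_at R p m.
  by split=> [m|n m]; case: (pt m).
have [W [q [phi [[weq_q [h [ch [K [cK K0 K1 _]] ->]]] weq_phi]]]] := M_perfect.
have [w [g [cg g0 g1]]] := weq_pi0_surj weq_phi m.
apply: (simple_divisible_route (Route cg g0 g1)).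
have p_gt1 := prime_gt1 p_prime.
split.
- exact: (frobenius_commute ch cK K0 K1 weq_phi p_gt1).
- exact: (frobenius_act ch cK K0 K1 weq_phi p_gt1).
- exact: (frobenius_divisible ch cK K0 K1 weq_phi p_gt1).
Qed.
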